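(* Let $\boldsymbol V=(V_t)_{t\in[0,1]}$ be a standard generalized Pareto process with generator process $\boldsymbol Z=(Z_t)_{t\in[0,1]}$. Let $\mathcal G_d=\{s_0^{(d)},\dots,s_d^{(d)}\}$, $0=s_0^{(d)}<\dots<s_d^{(d)}=1$, $d\in\mathbb{N}$, be a sequence of grids in $[0,1]$ with diameter $\max_{i=1,\dots,d}(s_i^{(d)}-s_{i-1}^{(d)})\to0$ as $d\to\infty$, and let $\hat{\boldsymbol V}^{(d)}$ be the discretized version of $\boldsymbol V$ with grid $\mathcal G_d$. Then the sequence of processes $\hat{\boldsymbol V}^{(d)}$, $d\in\mathbb{N}$, converges uniformly to $\boldsymbol V$ pathwise, i.e. $\|\hat{\boldsymbol V}^{(d)}-\boldsymbol V\|_\infty\to_{d\to\infty}0$ with probability one.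
   Context: $\bar C^+[0,1]$ and $\bar C^-[0,1]$ are the nonnegative and nonpositive functions in $C[0,1]$. $E[0,1]$ is the set of bounded functions $f:[0,1]\to\mathbb{R}$ with only finitely many discontinuities, $\bar E^-[0,1]=\{f\in E[0,1]:f\le0\}$, and $\|\cdot\|_\infty$ is the sup-norm. Generator process: a process $\boldsymbol Z=(Z_t)_{t\in[0,1]}$ with sample paths in $\bar C^+[0,1]$, $Z_t\le c$ a.s. for some constant $c\ge1$ and $E(Z_t)=1$ for all $t$; it generates the $D$-norm $\|f\|_D=E(\sup_{t\in[0,1]}|f(t)|Z_t)$ on $E[0,1]$. Standard generalized Pareto process (SGPP): a process $\boldsymbol V$ with sample paths in $\bar C^-[0,1]$ for which there are a $D$-norm $\|\cdot\|_D$ on $E[0,1]$ and some $c_0>0$ with $P(\boldsymbol V\le f)=1-\|f\|_D$ for all $f\in\bar E^-[0,1]$ with $\|f\|_\infty\le c_0$. A generator process of $\boldsymbol V$ is a generator process of this $D$-norm. Discretized version: for a grid $0=s_0<s_1<\dots<s_d=1$ put $\|(x,y)\|_{D_{i-1,i}}=E(\max(|x|Z_{s_{i-1}},|y|Z_{s_i}))$, $i=1,\dots,d$. The discretized version of $\boldsymbol V$ with this grid is $$\hat V_t=\|(s_i-t,t-s_{i-1})\|_{D_{i-1,i}}\max\left(\frac{V_{s_{i-1}}}{s_i-t},\frac{V_{s_i}}{t-s_{i-1}}\right),\quad t\in[s_{i-1},s_i],\ i=1,\dots,d.$$ Convention: $V_{s_i}<0$ a.s., and $x/0:=-\infty$ for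 $x<0$. *)

(* Defs.v *)
From HB Require Import structures.
From mathcomp Require Import all_boot all_order all_algebra.
From mathcomp Require Import all_classical all_reals all_analysis.
From mathcomp Require Import measurable_realfun.

Set Implicit Arguments.
Unset Strict Implicit.
Unset Printing Implicit Defensive.

Import Order.TTheory GRing.Theory Num.Theory.
Import numFieldNormedType.Exports.

Local Open Scope classical_set_scope.
Local Open Scope ring_scope.
Local Open Scope ereal_scope.

(* Functions on [0,1] are represented by functions on R, and processes indexed
   by [0,1] by functions R -> T -> R (time first); values at times outside
   [0,1] never matter. *)

Definition I01 (R : realType) : set R := `[0%R, 1%R]%classic.
Arguments I01 {R}.

(* The sup-norm lives in \bar R so that it is meaningful (equal to +oo) for
   unbounded functions; its argument is \bar R-valued because [discretized]
   below is. *)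
Definition supnorm (R : realType) (g : R -> \bar R) : \bar R :=
  ereal_sup [set `|g t| | t in I01].

(* E[0,1]; continuity at the end points is one-sided *)
Definition spaceE (R : realType) (f : R -> R) : Prop :=
  [bounded f t | t in I01] /\
  finite_set [set t | I01 t /\ ~ (f x @[x --> within I01 (nbhs t)] --> f t)].

Definition spaceEneg (R : realType) (f : R -> R) : Prop :=
  spaceE f /\ forall t, I01 t -> (f t <= 0)%R.

Definition continuous_process (R : realType) (dT : measure_display)
    (T : measurableType dT) (X : R -> T -> R) : Prop :=
  (forall t, I01 t -> measurable_fun setT (X t)) /\
  (forall w, {within I01, continuous (fun t => X t w)}).

Definition generator_process (R : realType) (dS : measure_display)
    (S : measurableType dS) (Q : probability S R) (Z : R -> S -> R) : Prop :=
  [/\ continuous_process Z,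
      forall w t, I01 t -> (0 <= Z t w)%R,
      exists2 c : R, (1 <= c)%R &
        forall t, I01 t -> {ae Q, forall w, (Z t w <= c)%R} &
      forall t, I01 t -> 'E_Q[Z t] = 1].

Definition Dnorm (R : realType) (dS : measure_display)
    (S : measurableType dS) (Q : probability S R) (Z : R -> S -> R)
    (f : R -> R) : \bar R :=
  'E_Q[fun w => sup [set (`|f t| * Z t w)%R | t in I01]].

(* The generator process may live on a probability space of its own: only its
   law enters the D-norm. *)
Definition SGPP_with_generator (R : realType) (dT : measure_display)
    (T : measurableType dT) (P : probability T R) (V : R -> T -> R)
    (dS : measure_display) (S : measurableType dS) (Q : probability S R)
    (Z : R -> S -> R) : Prop :=
  [/\ continuous_process V,
      forall w t, I01 t -> (V t w <= 0)%R,
      generator_process Q Z &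
      exists2 c0 : R, (0 < c0)%R &
        forall f : R -> R, spaceEneg f -> supnorm (EFin \o f) <= c0%:E ->
          P [set w | forall t, I01 t -> (V t w <= f t)%R] = 1 - Dnorm Q Z f].

Definition is_grid (R : realType) (d : nat) (s : nat -> R) : Prop :=
  [/\ s 0%N = 0%R, s d = 1%R & forall i, (i < d)%N -> (s i < s i.+1)%R].

Definition diameter (R : realType) (d : nat) (s : nat -> R) : R :=
  (\big[Num.max/0]_(i < d) (s i.+1 - s i))%R.

Definition Dnorm2 (R : realType) (dS : measure_display)
    (S : measurableType dS) (Q : probability S R) (Z : R -> S -> R)
    (a b x y : R) : \bar R :=
  'E_Q[fun w => Num.max (`|x| * Z a w)%R (`|y| * Z b w)%R].

(* The interpolation between the times a and b. Division in \bar R satisfies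
   x / 0 = -oo for x < 0. *)
Definition interpolant (R : realType) (dT : measure_display)
    (T : measurableType dT) (V : R -> T -> R) (dS : measure_display)
    (S : measurableType dS) (Q : probability S R) (Z : R -> S -> R)
    (a b t : R) (w : T) : \bar R :=
  Dnorm2 Q Z a b (b - t) (t - a) *
  maxe ((V a w)%:E / (b - t)%:E) ((V b w)%:E / (t - a)%:E).

(* 0-based index i of the first cell [s i, s i.+1] containing t; the choice
   made at grid points is immaterial by [discretizedE] below *)
Definition cell (R : realType) (d : nat) (s : nat -> R) (t : R) : nat :=
  find (fun i => (t <= s i.+1)%R) (iota 0 d).

Definition discretized (R : realType) (dT : measure_display)
    (T : measurableType dT) (V : R -> T -> R) (dS : measure_display)
    (S : measurableType dS) (Q : probability S R) (Z : R -> S -> R)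
    (d : nat) (s : nat -> R) (t : R) (w : T) : \bar R :=
  interpolant V Q Z (s (cell d s t)) (s (cell d s t).+1) t w.

Lemma grid_le (R : realType) (d : nat) (s : nat -> R) :
  is_grid d s -> forall i j, (i <= j)%N -> (j <= d)%N -> (s i <= s j)%R.
Proof.
move=> [_ _ sS] i j; elim: j => [|j IH]; first by rewrite leqn0 => /eqP ->.
rewrite leq_eqVlt => /predU1P[->//|]; rewrite ltnS => ij jd.
by apply: (le_trans (IH ij (ltnW jd))); exact/ltW/sS.
Qed.

Lemma interpolant_right (R : realType) (dT : measure_display)
    (T : measurableType dT) (V : R -> T -> R) (dS : measure_display)
    (S : measurableType dS) (Q : probability S R) (Z : R -> S -> R)
    (a b : R) (w : T) :
  generator_process Q Z -> I01 a -> I01 b -> (a < b)%R -> (V a w < 0)%R ->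
  interpolant V Q Z a b b w = (V b w)%:E.
Proof.
move=> [[mZ _] Z0 _ EZ] a01 b01 ab Va.
rewrite /interpolant /Dnorm2 subrr inve0 normr0.
have ba : (0 < b - a)%R by rewrite subr_gt0.
have -> : (fun w0 => Num.max (0 * Z a w0) (`|b - a| * Z b w0))%R =
          (fun w0 => (b - a) * Z b w0)%R.
  apply/funext => x; rewrite mul0r gtr0_norm// max_r//.
  by rewrite mulr_ge0 ?Z0// ltW.
have EZb := EZ b b01; rewrite unlock in EZb *.
under eq_integral do rewrite EFinM.
rewrite ge0_integralZl//; last 3 first.
- by apply/measurable_EFinP; exact: mZ.
- by move=> x _; rewrite lee_fin Z0.
- by rewrite lee_fin ltW.
rewrite EZb mule1 lt0_muley ?lte_fin// maxNye inver gt_eqF//.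
by rewrite -!EFinM mulrCA divff ?mulr1// gt_eqF.
Qed.

Lemma interpolant_left (R : realType) (dT : measure_display)
    (T : measurableType dT) (V : R -> T -> R) (dS : measure_display)
    (S : measurableType dS) (Q : probability S R) (Z : R -> S -> R)
    (a b : R) (w : T) :
  generator_process Q Z -> I01 a -> I01 b -> (a < b)%R -> (V b w < 0)%R ->
  interpolant V Q Z a b a w = (V a w)%:E.
Proof.
move=> [[mZ _] Z0 _ EZ] a01 b01 ab Vb.
rewrite /interpolant /Dnorm2 subrr inve0 normr0.
have ba : (0 < b - a)%R by rewrite subr_gt0.
have -> : (fun w0 => Num.max (`|b - a| * Z a w0) (0 * Z b w0))%R =
          (fun w0 => (b - a) * Z a w0)%R.
  apply/funext => x; rewrite mul0r gtr0_norm// max_l//.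
  by rewrite mulr_ge0 ?Z0// ltW.
have EZa := EZ a a01; rewrite unlock in EZa *.
under eq_integral do rewrite EFinM.
rewrite ge0_integralZl//; last 3 first.
- by apply/measurable_EFinP; exact: mZ.
- by move=> x _; rewrite lee_fin Z0.
- by rewrite lee_fin ltW.
rewrite EZa mule1 lt0_muley ?lte_fin// maxeNy inver gt_eqF//.
by rewrite -!EFinM mulrCA divff ?mulr1// gt_eqF.
Qed.

(* On the almost sure event that V < 0 at the grid points, the interpolation
   formula holds on every cell containing t. *)
Lemma discretizedE (R : realType) (dT : measure_display)
    (T : measurableType dT) (V : R -> T -> R) (dS : measure_display)
    (S : measurableType dS) (Q : probability S R) (Z : R -> S -> R)
    (d : nat) (s : nat -> R) (i : nat) (t : R) (w : T) :
  generator_process Q Z -> is_grid d s ->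
  (forall j, (j <= d)%N -> (V (s j) w < 0)%R) ->
  (i < d)%N -> (s i <= t <= s i.+1)%R ->
  discretized V Q Z d s t w = interpolant V Q Z (s i) (s i.+1) t w.
Proof.
move=> gZ gs Vneg id_ /andP[sit tsi]; have [s0 s1 sS] := gs.
have s01 j : (j <= d)%N -> I01 (s j).
  move=> jd; rewrite /I01 /= in_itv /= -{1}s0 -s1.
  by rewrite !(grid_le gs).
rewrite /discretized; set k := cell d s t.
have hask : has (fun i => (t <= s i.+1)%R) (iota 0 d).
  by apply/hasP; exists i => //; rewrite mem_iota.
have kd : (k < d)%N by move: hask; rewrite has_find size_iota.
have tk : (t <= s k.+1)%R.
  by have := nth_find 0%N hask; rewrite -/(cell d s t) -/k nth_iota.
have ki : (k <= i)%N.
  rewrite leqNgt; apply/negP => ik.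
  by have := before_find 0%N ik; rewrite nth_iota// add0n tsi.
move: ki; rewrite leq_eqVlt => /predU1P[->//|ki].
have tE : t = s k.+1.
  by apply/eqP; rewrite eq_le tk (le_trans _ sit)// (grid_le gs)// ltnW.
have iE : i = k.+1.
  apply/eqP; rewrite eqn_leq ki andbT leqNgt; apply/negP => ki2.
  have : (s k.+2 <= s k.+1)%R.
    by rewrite -tE (le_trans _ sit)// (grid_le gs)// ltnW.
  by rewrite leNgt sS// (leq_ltn_trans ki).
rewrite {}iE in id_ *; rewrite tE.
by rewrite interpolant_right ?interpolant_left//;
  first [exact: sS|apply: s01 => //; exact: ltnW|exact: Vneg|
         apply: Vneg; do 2?exact: ltnW].
Qed.

(* Main.v *)
(* On a cell [a, b] containing t put m = max(b - t, t - a) and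
   D = ||(b - t, t - a)||_{D_{a,b}}. Since E(Z_a) = E(Z_b) = 1,
   m <= D <= m (1 + E|Z_a - Z_b|), and since V_a, V_b < 0, the interpolant
   D max(V_a / (b - t), V_b / (t - a)) then lies between
   (1 + E|Z_a - Z_b|) min(V_a, V_b) and max(V_a, V_b). The expectation
   E|Z_a - Z_b| is small uniformly in |a - b| by dominated convergence, and
   V_a, V_b are close to V_t by uniform continuity of the path of V.

   That V < 0 on [0,1] almost surely follows from
   P(V <= -c) = 1 - c E(sup Z) as c -> 0; here E(sup Z) is finite because
   the left-hand side is nonnegative at c = c0. *)

Require Import Defs.
From HB Require Import structures.
From mathcomp Require Import all_boot all_order all_algebra.
From mathcomp Require Import all_classical all_reals all_analysis.
From mathcomp Require Import measurable_realfun ring lra.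
Import Order.TTheory GRing.Theory Num.Theory.
Import numFieldNormedType.Exports.
Local Open Scope classical_set_scope.
Local Open Scope ring_scope.
Local Open Scope ereal_scope.

Set Implicit Arguments.
Unset Strict Implicit.
Unset Printing Implicit Defensive.

(** * Continuous paths on [0,1]: uniform continuity, measurability, boundedness *)

(** Heine-Cantor through the near-covering form of compactness: the modulus ranges over the filter
    of positive radii tending to 0, so a modulus valid near each point becomes valid on all of
    [0,1]. *)
Lemma unif_continuous_I01 (R : realType) (f : R -> R) :
  {within I01, continuous f} -> forall e : R, (0 < e)%R ->
  exists2 r : R, (0 < r)%R & forall x y, I01 x -> I01 y ->
    (`|x - y| < r)%R -> (`|f x - f y| < e)%R.
Proof.
move=> /subspace_continuousP cf e e0.
have /compact_near_coveringP/(_ R (0%R : R)^'+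
    (fun r x => I01 x -> forall y, I01 y -> (`|x - y| < r)%R ->
      (`|f x - f y| < e)%R)) := @segment_compact R 0%R 1%R.
case.
- move=> x x01.
  have e20 : (0 < e / 2)%R by rewrite divr_gt0.
  have /cvgrPdist_lt/(_ _ e20) := cf x x01.
  rewrite near_withinE => /nbhs_ballP[r /= r0 xr].
  have near_x (z : R) : I01 z -> (`|x - z| < r)%R -> (`|f x - f z| < e / 2)%R.
    by move=> z01 xz; exact: (xr z).
  have r20 : (0 < r / 2)%R by rewrite divr_gt0.
  exists (ball x (r / 2), [set u : R | u < r / 2]%R).
    by split; [exact: nbhsx_ballx|exact: nbhs_right_lt].
  move=> [z u] /= [xz ur] z01 y y01 zy.
  rewrite (splitr e) (le_lt_trans (ler_distD (f x) _ _))//.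
  rewrite ltrD//; first rewrite distrC; apply: near_x => //.
    by rewrite (lt_le_trans xz)// ler_pdivrMr// ler_peMr ?ler1n// ltW.
  rewrite (splitr r) (le_lt_trans (ler_distD z _ _))// ltrD//.
  exact: (lt_trans zy).
- move=> r /= r0 rP; exists (r / 2)%R; first by rewrite divr_gt0.
  move=> x y x01 y01 xy; apply: (rP (r / 2)%R) => //=.
    rewrite sub0r normrN gtr0_norm ?divr_gt0// ltr_pdivrMr//.
    by rewrite ltr_pMr// ltr1n.
  by rewrite divr_gt0.
Qed.

Lemma fractions_dense_I01 (R : realType) (t r : R) : I01 t -> (0 < r)%R ->
  exists n k, I01 (k%:R / n.+1%:R : R)%R /\ (`|t - k%:R / n.+1%:R| < r)%R.
Proof.
(* Rounding down keeps the fraction in [0,1]; the error is below [1 / n.+1], and [n.+1] exceeds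
   [1 / r]. *)
rewrite /I01/= in_itv/= => /andP[t0 t1] r0.
pose n := Num.truncn (r^-1)%R; pose k := Num.truncn (t * n.+1%:R)%R.
exists n, k; have n0 : (0 < n.+1%:R :> R)%R by rewrite ltr0n.
have tn0 : (0 <= t * n.+1%:R)%R by rewrite mulr_ge0// ltW.
have /andP[kt tk] := truncn_itv tn0.
have kt' : (k%:R / n.+1%:R <= t)%R by rewrite ler_pdivrMr.
split; first by rewrite in_itv/= divr_ge0// (le_trans kt').
rewrite ger0_norm ?subr_ge0// ltrBlDl -ltrBlDr.
rewrite ltr_pdivlMr// mulrBl ltrBlDr (lt_le_trans tk)//.
rewrite -[leLHS]natr1 lerD2l.
have /andP[_ rn] := truncn_itv (ltW (etrans (invr_gt0 r) r0)).
by rewrite -ler_pdivrMl// mulr1 ltW.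
Qed.

(** By path continuity it suffices to test the fractions in [0,1], so the event is a countable
    intersection. [A n k] is the whole space when its fraction lies outside [0,1]. *)
Lemma continuous_process_le_measurable (R : realType) (dT : measure_display)
    (T : measurableType dT) (X : R -> T -> R) (y : R) :
  continuous_process X ->
  measurable [set w | forall t, I01 t -> (X t w <= y)%R].
Proof.
move=> [mX cX].
pose A n k := [set w | I01 (k%:R / n.+1%:R : R)%R ->
  (X (k%:R / n.+1%:R)%R w <= y)%R].
rewrite (_ : [set _ | _] = \bigcap_n \bigcap_k A n k).
  apply: bigcapT_measurable => n; apply: bigcapT_measurable => k.
  have [q01|nq] := pselect (I01 (k%:R / n.+1%:R : R)%R); last first.
    rewrite (_ : A n k = setT)//; apply/seteqP; split => // w _ /=.
    by rewrite /A/= => q.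
  rewrite (_ : A n k = X (k%:R / n.+1%:R)%R @^-1` `]-oo, y]).
    by rewrite -[X in measurable X]setTI; exact: mX.
  apply/seteqP; split => w /=; rewrite /A/= in_itv/=; first exact.
  by move=> ? _.
apply/seteqP; split => w /= Hw; first by move=> n _ k _ q01; exact: Hw.
move=> t t01; apply/ler_addgt0Pr => e e0.
have [r r0 rP] := unif_continuous_I01 (cX w) e0.
have [n [k [q01 tq]]] := fractions_dense_I01 t01 r0.
have := rP _ _ t01 q01 tq; have := Hw n I k I q01.
by rewrite ltr_distlC => Xq /andP[]; lra.
Qed.
Lemma continuous_bounded_I01 (R : realType) (f : R -> R) :
  {within I01, continuous f} ->
  exists2 K : R, (0 < K)%R & forall t, I01 t -> (`|f t| <= K)%R.
Proof.
move=> cf; have := continuous_compact cf (@segment_compact R 0%R 1%R).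
move=> /compact_bounded[M [_ MP]].
exists (`|M| + 1)%R; first by rewrite ltr_wpDl.
move=> t t01; apply: (MP (`|M| + 1)%R); last by exists t.
by rewrite (le_lt_trans (ler_norm _))// ltrDl.
Qed.

(** * The supremum of a path and the D-norm of constant functions *)

Section path_supremum.
Context (R : realType) (dS : measure_display) (S : measurableType dS).
Variable Z : R -> S -> R.
Hypothesis cZ : continuous_process Z.

Definition path_sup (w : S) : R := sup [set Z t w | t in I01].

Let zero01 : I01 (0%R : R).
Proof. by rewrite /I01/= in_itv/= lexx ler01. Qed.

Lemma path_nonempty w : [set Z t w | t in I01] !=set0.
Proof. by exists (Z 0%R w), 0%R. Qed.

Lemma path_ubounded w : has_ubound [set Z t w | t in I01].
Proof.
have [K _ KP] := continuous_bounded_I01 (cZ.2 w).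
by exists K => _ [t t01 <-]; rewrite (le_trans (ler_norm _))// KP.
Qed.

Lemma path_sup_le w y :
  (path_sup w <= y)%R <-> forall t, I01 t -> (Z t w <= y)%R.
Proof.
split=> [wy t t01|wy].
  by apply: le_trans wy; apply: ub_le_sup; [exact: path_ubounded|exists t].
by apply: ge_sup; [exact: path_nonempty|move=> _ [t t01 <-]; exact: wy].
Qed.

Lemma measurable_path_sup : measurable_fun setT path_sup.
Proof.
apply: (measurability _ (RGenOInfty.measurableE R)) => //.
move=> _ [_ [y ->] <-]; rewrite setTI.
rewrite (_ : _ @^-1` _ = ~` [set w | forall t, I01 t -> (Z t w <= y)%R]).
  by apply: measurableC; exact: continuous_process_le_measurable.
apply/seteqP; split => w /=; rewrite in_itv/= andbT.
  by rewrite ltNge => /negP nwy /path_sup_le.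
by move=> nwy; rewrite ltNge; apply/negP => /path_sup_le.
Qed.

Lemma path_sup_ge0 w : (forall t, I01 t -> (0 <= Z t w)%R) ->
  (0 <= path_sup w)%R.
Proof.
move=> Z0; apply: le_trans (Z0 _ zero01) _.
by apply/(path_sup_le w _).1: zero01.
Qed.

Lemma path_supZ w a : (0 < a)%R ->
  sup [set (a * Z t w)%R | t in I01] = (a * path_sup w)%R.
Proof.
move=> a0; apply/eqP; rewrite eq_le; apply/andP; split.
  apply: ge_sup; first by exists (a * Z 0 w)%R, 0%R.
  move=> _ [t t01 <-]; rewrite ler_pM2l//.
  exact: (path_sup_le w _).1 t t01.
rewrite mulrC -ler_pdivlMr//; apply/path_sup_le => t t01.
rewrite ler_pdivlMr// mulrC; apply: ub_le_sup; last by exists t.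
exists (a * path_sup w)%R => _ [u u01 <-]; rewrite ler_pM2l//.
exact: (path_sup_le w _).1 u u01.
Qed.

Lemma Dnorm_cst (Q : probability S R) (a : R) : (0 < a)%R ->
  (forall w t, I01 t -> (0 <= Z t w)%R) ->
  Dnorm Q Z (cst (- a)%R) = a%:E * 'E_Q[path_sup].
Proof.
move=> a0 Z0; rewrite /Dnorm unlock.
rewrite -ge0_integralZl//; first last.
- by rewrite lee_fin ltW.
- by move=> w _; rewrite lee_fin path_sup_ge0// => t; exact: Z0.
- by apply/measurable_EFinP; exact: measurable_path_sup.
apply: eq_integral => w _; rewrite -EFinM -path_supZ//=.
by rewrite normrN gtr0_norm.
Qed.

End path_supremum.

(** * Almost sure strict negativity of the standard generalized Pareto process *)

Lemma spaceEneg_cst (R : realType) (a : R) : (0 <= a)%R ->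
  @spaceEneg R (cst (- a)%R).
Proof.
move=> a0; split; last by move=> t _ /=; rewrite oppr_le0.
split.
  exists a; split; first by rewrite num_real.
  by move=> x ax t _ /=; rewrite normrN ger0_norm// ltW.
rewrite (_ : [set _ | _] = set0)//.
by apply/seteqP; split => t //= [_]; apply; exact: cvg_cst.
Qed.

Lemma SGPP_bounded_away_from_zero (R : realType)
    (dT : measure_display) (T : measurableType dT) (P : probability T R)
    (dS : measure_display) (S : measurableType dS) (Q : probability S R)
    (V : R -> T -> R) (Z : R -> S -> R) :
  SGPP_with_generator P V Q Z ->
  {ae P, forall w, exists2 e : R, (0 < e)%R &
    forall t, I01 t -> (V t w <= - e)%R}.
Proof.
move=> [cV V0 [cZ Z0 _ _] [c0 c00 PV]].
pose A e := [set w | forall t, I01 t -> (V t w <= - e)%R].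
have mA e : measurable (A e) by exact: continuous_process_le_measurable.
have PA e : (0 < e <= c0)%R -> P (A e) = 1 - e%:E * 'E_Q[path_sup Z].
  move=> /andP[e0 ec0]; rewrite -Dnorm_cst//; apply: PV.
    by apply: spaceEneg_cst; exact: ltW.
  apply/ereal_supP => _ [t t01 <-] /=.
  by rewrite normrN gtr0_norm// lee_fin.
have EM0 : 0 <= 'E_Q[path_sup Z].
  by apply: expectation_ge0 => w; apply: path_sup_ge0 => // t; exact: Z0.
have EMfin : 'E_Q[path_sup Z] \is a fin_num.
  rewrite ge0_fin_numE// ltNge leye_eq; apply/negP => /eqP EMy.
  have : 0 <= P (A c0) by []; rewrite PA ?c00 ?lexx// EMy.
  by rewrite gt0_muley ?lte_fin.
(* Since [harmonic n] is 1/(n+1), every level [u n] lies in (0, c0], where [PA] applies. *)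
pose u n := (c0 * harmonic n)%R.
have u0 n : (0 < u n <= c0)%R.
  rewrite /u mulr_gt0 ?invr_gt0 ?ltr0n//= ger_pMr//.
  by rewrite invf_le1 ?ltr0n// ler1n.
pose N := \bigcap_n ~` A (u n).
have mN : measurable N by apply: bigcapT_measurable => n; exact: measurableC.
exists N; split => //; last first.
  move=> w /= nw n _ /= An; apply: nw; exists (u n) => //.
  by have /andP[] := u0 n.
have PN n : P N <= (u n)%:E * 'E_Q[path_sup Z].
  apply: (@le_trans _ _ (P (~` A (u n)))).
    by apply: le_measure; rewrite ?inE//; [exact: measurableC|exact: bigcap_inf].
  rewrite probability_setC// PA//.
  by rewrite -(fineK EMfin) -EFinM -!EFinB lee_fin; lra.
apply/eqP; rewrite eq_le measure_ge0 andbT.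
have : (u n)%:E * 'E_Q[path_sup Z] @[n --> \oo] --> 0.
  rewrite -(fineK EMfin) -[X in _ --> X](mul0e (fine 'E_Q[path_sup Z])%:E).
  apply: cvgeZr => //; apply: cvg_EFin; first exact: nearW.
  rewrite -(mulr0 c0); apply: cvgMl_tmp; exact: cvg_harmonic.
by apply: cvge_ge; exact: nearW.
Qed.

(** * Moment estimates for the generator and the error of one interpolation cell *)

(** Otherwise there are pairs of times at distance below 1/(n+1) whose L1 distance stays above [e].
    Uniform continuity of each path makes the differences tend to 0 pointwise, although the pairs
    themselves may not converge, and dominated convergence gives a contradiction. *)
Lemma generator_L1_unif_continuous (R : realType) (dS : measure_display)
    (S : measurableType dS) (Q : probability S R) (Z : R -> S -> R) :
  generator_process Q Z -> forall e : R, (0 < e)%R ->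
  exists2 r : R, (0 < r)%R & forall a b, I01 a -> I01 b -> (`|a - b| < r)%R ->
    \int[Q]_w `|Z a w - Z b w|%:E <= e%:E.
Proof.
move=> [[mZ cZ] Z0 [c c1 Zc] _] e e0; apply: contrapT => nunif.
have /choice[ab abP] n : exists ab : R * R, [/\ I01 ab.1, I01 ab.2,
    (`|ab.1 - ab.2| < harmonic n)%R &
    e%:E < \int[Q]_w `|Z ab.1 w - Z ab.2 w|%:E].
  apply: contrapT => nab; apply: nunif; exists (harmonic n) => //.
    by rewrite invr_gt0 ltr0n.
  move=> a b a01 b01 rab; rewrite leNgt; apply/negP => eab.
  by apply: nab; exists (a, b).
pose f n w := `|Z (ab n).1 w - Z (ab n).2 w|%:E.
have mf n : measurable_fun setT (f n).
  have [a01 b01 _ _] := abP n; apply/measurable_EFinP.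
  by apply: measurableT_comp => //; apply: measurable_funB; exact: mZ.
(* The null set in [Zc] depends on the time, but only the countably many times in [ab] occur. *)
have fc : {ae Q, forall w n, setT w -> `|f n w| <= (cst (2 * c)%:E) w}.
  apply: ae_foralln => n; have [a01 b01 _ _] := abP n.
  apply: filterS2 (Zc _ a01) (Zc _ b01) => w Zac Zbc _ /=.
  rewrite lee_fin normr_id ler_norml.
  by have := Z0 w _ a01; have := Z0 w _ b01; lra.
have f0 : {ae Q, forall w, setT w -> f n w @[n --> \oo] --> cst 0 w}.
  apply: aeW => w _; apply: cvg_EFin; first exact: nearW.
  apply/cvgrPdist_lt => x x0.
  have [r r0 rP] := unif_continuous_I01 (cZ w) x0.
  have := @cvg_harmonic R; move=> /cvgrPdist_lt/(_ _ r0).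
  apply: filterS => n /=.
  rewrite !sub0r !normrN normr_id ger0_norm// => nr.
  by have [a01 b01 /lt_trans/(_ nr) abr _] := abP n; exact: rP.
have ic : Q.-integrable setT (cst (2 * c)%:E).
  exact: finite_measure_integrable_cst.
have [_ _] := dominated_convergence measurableT mf
  (measurable_cst _) f0 ic fc.
rewrite integral0 => lim0.
have : e%:E <= 0.
  by apply: cvge_ge lim0; apply: nearW => n; have [_ _ _ /ltW] := abP n.
by rewrite lee_fin leNgt e0.
Qed.

(** The integrand dominates both [p * Z a] and [q * Z b], whose expectations are [p] and [q]; it is
    dominated by [m * (Z a + |Z a - Z b|)]. Producing a real [r] also records finiteness, so that
    later computations stay in [R]. *)
Lemma Dnorm2_bounds (R : realType) (dS : measure_display)
    (S : measurableType dS) (Q : probability S R) (Z : R -> S -> R)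
    (a b p q e : R) :
  generator_process Q Z -> I01 a -> I01 b -> (0 <= p)%R -> (0 <= q)%R ->
  \int[Q]_w `|Z a w - Z b w|%:E <= e%:E ->
  exists2 r : R, Dnorm2 Q Z a b p q = r%:E &
    (Num.max p q <= r <= Num.max p q * (1 + e))%R.
Proof.
move=> [[mZ _] Z0 _ EZ] a01 b01 p0 q0 abe.
set m := Num.max p q.
have pm : (p <= m)%R by rewrite le_max lexx.
have qm : (q <= m)%R by rewrite le_max lexx orbT.
have m0 : (0 <= m)%R by exact: le_trans pm.
have mZE t : I01 t -> measurable_fun setT (EFin \o Z t).
  by move=> t01; apply/measurable_EFinP; exact: mZ.
have ZE0 t w : I01 t -> 0 <= (Z t w)%:E by move=> t01; rewrite lee_fin Z0.
have intZ t k : I01 t -> (0 <= k)%R -> \int[Q]_w (k%:E * (Z t w)%:E) = k%:E.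
  move=> t01 k0; rewrite ge0_integralZl//; first last.
  - by move=> w _; exact: ZE0.
  - exact: mZE.
  by have := EZ t t01; rewrite unlock => ->; rewrite mule1.
rewrite /Dnorm2 unlock (ger0_norm p0) (ger0_norm q0).
set F := fun w => (Num.max (p * Z a w) (q * Z b w))%:E.
have mF : measurable_fun setT F.
  apply/measurable_EFinP; apply: measurable_maxr;
    by apply: measurable_funM => //; exact: mZ.
have F0 w : setT w -> 0 <= F w.
  by move=> _; rewrite lee_fin le_max mulr_ge0// Z0.
have mabs : measurable_fun setT (fun w => `|Z a w - Z b w|%:E).
  apply/measurable_EFinP; apply: measurableT_comp => //.
  by apply: measurable_funB; exact: mZ.
have Flb t k : I01 t -> (0 <= k)%R ->
    (forall w, k%:E * (Z t w)%:E <= F w) -> k%:E <= \int[Q]_w F w.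
  move=> t01 k0 kF; rewrite -(intZ t k t01 k0).
  apply: ge0_le_integral => //.
    by move=> w _; rewrite mule_ge0 ?ZE0.
  by apply: measurable_funeM; exact: mZE.
have Fub : \int[Q]_w F w <= (m * (1 + e))%:E.
  have intm : \int[Q]_w (m%:E * ((Z a w)%:E + `|Z a w - Z b w|%:E)) <=
      (m * (1 + e))%:E.
    rewrite ge0_integralZl//; first last.
    - by move=> w _; rewrite adde_ge0 ?ZE0 ?lee_fin.
    - by apply: emeasurable_funD => //; exact: mZE.
    rewrite EFinM; apply: lee_wpmul2l; first by rewrite lee_fin.
    rewrite ge0_integralD//; last 2 first.
    - by move=> w _; exact: ZE0.
    - exact: mZE.
    by have := EZ a a01; rewrite unlock EFinD => ->; exact: leeD2l.
  apply: le_trans intm; apply: ge0_le_integral => //.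
    apply: measurable_funeM; apply: emeasurable_funD => //; exact: mZE.
  move=> w _; rewrite /F -EFinD -EFinM lee_fin ge_max; apply/andP; split.
    rewrite (le_trans (ler_wpM2r (Z0 w a a01) pm))// ler_wpM2l//.
    by rewrite lerDl.
  rewrite (le_trans (ler_wpM2r (Z0 w b b01) qm))// ler_wpM2l//.
  by rewrite -lerBlDl distrC ler_norm.
have Ffin : \int[Q]_w F w \is a fin_num.
  rewrite ge0_fin_numE ?integral_ge0//.
  exact: le_lt_trans Fub (ltry _).
exists (fine (\int[Q]_w F w)); first by rewrite fineK.
rewrite -!lee_fin fineK// Fub andbT EFin_max ge_max.
by apply/andP; split; [apply: (Flb a)|apply: (Flb b)] => // w;
  rewrite -EFinM lee_fin le_max lexx ?orbT.
Qed.

Lemma interpolant_close (R : realType) (dT : measure_display)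
    (T : measurableType dT) (V : R -> T -> R) (dS : measure_display)
    (S : measurableType dS) (Q : probability S R) (Z : R -> S -> R)
    (a b t e x K : R) (w : T) :
  generator_process Q Z -> I01 a -> I01 b -> (a < b)%R -> (a <= t <= b)%R ->
  \int[Q]_w `|Z a w - Z b w|%:E <= e%:E ->
  (V a w < 0)%R -> (V b w < 0)%R -> (0 <= x)%R ->
  (`|V a w - V t w| <= x)%R -> (`|V b w - V t w| <= x)%R ->
  (`|V t w| <= K)%R ->
  `|interpolant V Q Z a b t w - (V t w)%:E| <= (e * K + (1 + e) * x)%:E.
Proof.
move=> gZ a01 b01 ab /andP[at_ tb] abe Va Vb x0 Vat Vbt VtK.
have e0 : (0 <= e)%R.
  by rewrite -lee_fin; apply: le_trans abe; apply: integral_ge0.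
have K0 : (0 <= K)%R by exact: le_trans VtK.
have bound0 : (0 <= e * K + (1 + e) * x)%R.
  by rewrite addr_ge0 ?mulr_ge0// addr_ge0.
(* At the end points of the cell one quotient is -oo, and interpolation is exact there. In the
   interior both denominators are positive and all terms are real. *)
have [->|ta] := eqVneq t a.
  by rewrite interpolant_left// -EFinB subrr abse0 lee_fin.
have [->|tb'] := eqVneq t b.
  by rewrite interpolant_right// -EFinB subrr abse0 lee_fin.
have p0 : (0 < b - t)%R by rewrite subr_gt0 lt_neqAle tb'.
have q0 : (0 < t - a)%R by rewrite subr_gt0 lt_neqAle eq_sym ta.
rewrite /interpolant.
have [r -> /andP[]] := Dnorm2_bounds gZ a01 b01 (ltW p0) (ltW q0) abe.
move: p0 q0; set p := (b - t)%R; set q := (t - a)%R => p0 q0.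
set m := Num.max p q => mr rm.
have pm : (p <= m)%R by rewrite le_max lexx.
have qm : (q <= m)%R by rewrite le_max lexx orbT.
have m0 : (0 < m)%R by exact: lt_le_trans pm.
have rm1 : (1 <= r / m)%R by rewrite ler_pdivlMr// mul1r.
have rme : (r / m <= 1 + e)%R by rewrite ler_pdivrMr// mulrC.
have r0 : (0 <= r)%R by apply: le_trans mr; exact: ltW.
rewrite !inver !gt_eqF// -!EFinM -EFin_max -EFinM -EFinB lee_fin.
(* As [r / k] is at least [r / m], hence at least 1, multiplying the negative [v] by it can only
   decrease [v]. *)
have upper v k : (v < 0)%R -> (0 < k)%R -> (k <= m)%R ->
    (r * (v / k) <= v)%R.
  move=> v0 k0 km.
  rewrite mulrCA ger_nMr// (le_trans rm1)// ler_wpM2l// lef_pV2//.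
have lower v : (v < 0)%R -> ((1 + e) * v <= r * (v / m))%R.
  by move=> v0; rewrite mulrCA mulrC ler_nM2l.
have yle : (r * Num.max (V a w / p) (V b w / q) <= V t w + x)%R.
  rewrite maxr_pMr// ge_max !(le_trans (upper _ _ _ _ _))//.
    by move: Vbt; rewrite ler_distl; lra.
  by move: Vat; rewrite ler_distl; lra.
(* The maximum is bounded below by the quotient whose denominator is [m]; for that one the factor
   [r / m] is at most [1 + e]. *)
have yge : ((1 + e) * (V t w - x) <= r * Num.max (V a w / p) (V b w / q))%R.
  have [mE|mE] : m = p \/ m = q by rewrite /m; case: leP; [right|left].
    apply: (@le_trans _ _ (r * (V a w / p))%R); last first.
      by rewrite ler_wpM2l// le_max lexx.
    rewrite -mE (le_trans _ (lower _ Va))// ler_wpM2l ?addr_ge0//.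
    by move: Vat; rewrite ler_distl; lra.
  apply: (@le_trans _ _ (r * (V b w / q))%R); last first.
    by rewrite ler_wpM2l// le_max lexx orbT.
  rewrite -mE (le_trans _ (lower _ Vb))// ler_wpM2l ?addr_ge0//.
  by move: Vbt; rewrite ler_distl; lra.
have eVt : (- (e * K) <= e * V t w)%R.
  rewrite -mulrN ler_wpM2l//.
  by move: VtK; rewrite ler_norml => /andP[].
have ex0 : (0 <= e * x)%R by rewrite mulr_ge0.
have eK0 : (0 <= e * K)%R by rewrite mulr_ge0.
by rewrite ler_distl; apply/andP; split; lra.
Qed.

(** * Grid cells and pathwise convergence *)

Lemma cvge0_le (R : realType) (u : nat -> \bar R) :
  (forall n, 0 <= u n) ->
  (forall e : R, (0 < e)%R -> \forall n \near \oo, u n <= e%:E) ->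
  u n @[n --> \oo] --> 0.
Proof.
move=> u0 ue; apply/fine_cvgP; split.
  (* Early terms may be +oo; the bound for [e = 1] makes the terms eventually finite. *)
  apply: filterS (ue _ ltr01) => n un1.
  by rewrite ge0_fin_numE// (le_lt_trans un1)// ltry.
apply/cvgrPdist_le => e e0; apply: filterS (ue _ e0) => n une /=.
rewrite sub0r normrN ger0_norm ?fine_ge0// -lee_fin fineK//.
by rewrite ge0_fin_numE// (le_lt_trans une)// ltry.
Qed.

Lemma grid_I01 (R : realType) (d : nat) (s : nat -> R) (i : nat) :
  is_grid d s -> (i <= d)%N -> I01 (s i).
Proof.
move=> gs id; have [s0 s1 _] := gs.
by rewrite /I01/= in_itv/= -{1}s0 -s1 !(grid_le gs).
Qed.

Lemma grid_cell_exists (R : realType) (d : nat) (s : nat -> R) (t : R) :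
  (0 < d)%N -> is_grid d s -> I01 t ->
  exists2 i : nat, (i < d)%N & (s i <= t <= s i.+1)%R.
Proof.
move=> d0 [s0 s1 _]; rewrite /I01/= in_itv/= => /andP[t0 t1].
(* The least such index is the cell: minimality forces [s i <= t]. The index [d.-1] qualifies
   because [s d = 1]. *)
have : exists i, (i < d)%N && (t <= s i.+1)%R.
  by exists d.-1; rewrite prednK// leqnn s1.
move=> /ex_minnP[[|i] /andP[id ti] imin]; first by exists 0%N; rewrite // s0 t0.
exists i.+1; rewrite // ti andbT leNgt; apply/negP => /ltW tsi.
by have := imin i; rewrite (ltnW id) tsi => /(_ isT); rewrite ltnn.
Qed.

Lemma cell_le_diameter (R : realType) (d : nat) (s : nat -> R) (i : nat) :
  (i < d)%N -> (s i.+1 - s i <= diameter d s)%R.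
Proof.
by move=> id; exact: (@le_bigmax _ _ _ 0%R (fun i : 'I_d => s i.+1 - s i)%R
  (Ordinal id)).
Qed.

Unset Implicit Arguments.

Theorem theorem4p5 (R : realType)
    (dT : measure_display) (T : measurableType dT) (P : probability T R)
    (dS : measure_display) (S : measurableType dS) (Q : probability S R)
    (V : R -> T -> R) (Z : R -> S -> R)
    (s : nat -> nat -> R)
    (hV : SGPP_with_generator P V Q Z)
    (hs : forall d, (0 < d)%N -> is_grid d (s d))
    (hdiam : diameter d (s d) @[d --> \oo] --> (0 : R)%R) :
  {ae P, forall w : T,
    supnorm (fun t => discretized V Q Z d (s d) t w - (V t w)%:E)
      @[d --> \oo] --> 0}.
Proof.
have [[mV cV] _ gZ _] := hV.
(* One null set serves all grids, since [V] is negative at all times simultaneously outside it. The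
   rest is deterministic for a fixed [w]. *)
apply: filterS (SGPP_bounded_away_from_zero hV) => w [c c0 Vc].
have Vneg t : I01 t -> (V t w < 0)%R.
  by move=> t01; rewrite (le_lt_trans (Vc t t01))// oppr_lt0.
have [K K0 VK] := continuous_bounded_I01 (cV w).
apply: cvge0_le => [d|eps eps0].
  apply: le_ereal_sup_tmp.
  exists `|discretized V Q Z d (s d) 0%R w - (V 0%R w)%:E|; last exact: abse_ge0.
  by exists 0%R => //; rewrite /I01/= in_itv/= lexx ler01.
(* Chosen so that the two terms of the error bound in [interpolant_close] are each [eps / 2]. *)
pose e := (eps / (2 * K))%R; pose x := (eps / (2 * (1 + e)))%R.
have e0 : (0 < e)%R by rewrite divr_gt0// mulr_gt0.
have e10 : (0 < 1 + e)%R by rewrite addr_gt0.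
have x0 : (0 < x)%R by rewrite divr_gt0// mulr_gt0.
have epsE : (e * K + (1 + e) * x = eps)%R.
  rewrite /x; move: (1 + e)%R e10 => y y0; rewrite /e.
  by field; rewrite !gt_eqF.
have [r1 r10 Zr1] := generator_L1_unif_continuous gZ e0.
have [r2 r20 Vr2] := unif_continuous_I01 (cV w) x0.
(* A diameter below [r1] controls the L1 distance of the generator across a cell; one below [r2]
   controls the oscillation of the path of [V] there. *)
have r0 : (0 < Num.min r1 r2)%R by rewrite lt_min r10.
move/cvgrPdist_lt : hdiam => /(_ _ r0) hdiam.
near=> d.
have d0 : (0 < d)%N by near: d; exact: nbhs_infty_gt.
have : (`|0 - diameter d (s d)| < Num.min r1 r2)%R by near: d.
rewrite sub0r normrN => /(le_lt_trans (ler_norm _)).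
rewrite lt_min => /andP[dr1 dr2].
have gs := hs d d0; have [_ _ sS] := gs.
apply/ereal_supP => _ [t t01 <-].
have [i id sit] := grid_cell_exists d0 gs t01.
have sneg j : (j <= d)%N -> (V (s d j) w < 0)%R.
  by move=> jd; apply: Vneg; exact: grid_I01 jd.
rewrite (discretizedE gZ gs sneg id sit) -epsE.
have si01 := grid_I01 gs (ltnW id); have si101 := grid_I01 gs id.
have cd := cell_le_diameter (s d) id.
have ab := sS i id; have /andP[at_ tb] := sit.
apply: (interpolant_close gZ si01 si101 ab sit) => //.
- by apply: Zr1 => //; rewrite distrC gtr0_norm ?subr_gt0//; lra.
- exact: sneg (ltnW id).
- exact: sneg.
- exact: ltW.
- by apply/ltW/Vr2 => //; rewrite distrC ger0_norm ?subr_ge0//; lra.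
- by apply/ltW/Vr2 => //; rewrite ger0_norm ?subr_ge0//; lra.
- exact: VK.
Unshelve. all: by end_near.
Qed.
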